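(* Let $f:[c,d]\to\mathbb{R}$ (with $c<d$) be a cavex segment. Then the least upper bound of the secant-measures $S(\Omega)$ over partitions $\Omega$ of $[c,d]$, the greatest lower bound of the tangent-measures $T(\Omega)$ over partitions $\Omega$ of $[c,d]$, and the arc-length of the cavex segment are all equal.
   Context: A curve is a continuous function $f:[a,b]\to\mathbb{R}$ whose graph has a tangent line at every point of $[a,b]$ (one-sided at the endpoints; vertical tangents are not excluded). A cavex segment is a section of a curve over a closed interval $[c,d]$ on which it is either convex or concave. The arc-length is the distance between the two endpoints along the curve, i.e. the length of the curve in the usual sense. For a partition $\Omega=\{c=x_0<x_1<\dots<x_k=d\}$, $k\ge1$, put $y_j=f(x_j)$. Only partitions are considered for which, for every $j=1,\dots,k$, the tangents to the graph at $(x_{j-1},y_{j-1})$ and $(x_j,y_j)$ intersect; $(X_j,Y_j)$ is their intersection point (if the two tangents coincide, so that the graph over $[x_{j-1},x_j]$ is a straight segment, $(X_j,Y_j)$ is any point of that segment). Set $$s_j=\sqrt{(x_j-x_{j-1})^2+(y_j-y_{j-1})^2},$$ $$t_j=\sqrt{(X_j-x_{j-1})^2+(Y_j-y_{j-1})^2}+\sqrt{(x_j-X_j)^2+(y_j-Y_j)^2}.$$ The secant-measure is $S(\Omega)=\sum_{j=1}^k s_j$ and the tangent-measure is $T(\Omega)=\sum_{j=1}^k t_j$. *)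

(* Defs.v *)
(* MathComp / MathComp-Analysis *)
From HB Require Import structures.
From mathcomp Require Import all_boot all_order all_algebra.
From mathcomp Require Import all_classical all_reals all_analysis.

Set Implicit Arguments.
Unset Strict Implicit.
Unset Printing Implicit Defensive.

Import Order.TTheory GRing.Theory Num.Theory.
Import numFieldNormedType.Exports.

Local Open Scope classical_set_scope.
Local Open Scope ring_scope.

(* The library norm on R * R is the max norm, hence a separate Euclidean
   distance. *)
Definition euclid_dist (R : realType) (P Q : R * R) : R :=
  Num.sqrt ((Q.1 - P.1) ^+ 2 + (Q.2 - P.2) ^+ 2).

Definition graph_pt (R : realType) (f : R -> R) (x : R) : R * R := (x, f x).

Definition secant_slope (R : realType) (f : R -> R) (x y : R) : R :=
  (f y - f x) / (y - x).

(* l is the tangent line at (x, f x) to the graph of f over [a, b], i.e. the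
   limit position of the secant lines through (x, f x). The limit is taken
   inside [a, b], so it is one-sided at a and b. The absolute value in the
   vertical case is there because a line has no orientation. *)
Definition is_tangent_line (R : realType) (f : R -> R) (a b x : R)
    (l : set (R * R)) : Prop :=
  (exists2 m : R,
      secant_slope f x y @[y --> within `[a, b] x^'] --> m &
      l = [set P : R * R | P.2 = f x + m * (P.1 - x)])
  \/
  ((`|secant_slope f x y| : R) @[y --> within `[a, b] x^'] --> +oo /\
      l = [set P : R * R | P.1 = x]).

Definition is_curve (R : realType) (f : R -> R) (a b : R) : Prop :=
  [/\ a < b,
      {within `[a, b], continuous f} &
      forall x, x \in `[a, b] -> exists l, is_tangent_line f a b x l].

(* The section over [c, d] of the curve f : [a, b] -> R; taking a = c and b = d
   gives a curve that is itself cavex. *)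
Definition cavex_segment (R : realType) (f : R -> R) (a b c d : R) : Prop :=
  [/\ is_curve f a b, a <= c, c < d, d <= b &
      @convex_function R R^o `[c, d] f \/
      @convex_function R R^o `[c, d] (\- f)].

(* A partition c = x_0 < x_1 < ... < x_k = d is given, as in the library's
   itv_partition, by the sequence s = [:: x_1; ...; x_k]. *)
Definition part_pt (R : realType) (c d : R) (s : seq R) (j : nat) : R :=
  nth d (c :: s) j.

Definition tangents_meet (R : realType) (f : R -> R) (a b u v : R) : Prop :=
  exists l m, [/\ is_tangent_line f a b u l, is_tangent_line f a b v m &
                  l `&` m !=set0].

(* When the two tangents coincide, the graph over [u, v] is a straight segment
   and P may be any of its points. *)
Definition is_tangent_intersection (R : realType) (f : R -> R) (a b u v : R)
    (P : R * R) : Prop :=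
  exists l m, [/\ is_tangent_line f a b u l, is_tangent_line f a b v m,
                  l P, m P &
                  l = m -> u <= P.1 <= v /\ P.2 = f P.1].

Definition admissible (R : realType) (f : R -> R) (a b c d : R) (s : seq R) :
    Prop :=
  itv_partition c d s /\
  forall j, (j < size s)%N ->
    tangents_meet f a b (part_pt c d s j) (part_pt c d s j.+1).

Definition secant_measure (R : realType) (f : R -> R) (c d : R) (s : seq R) :
    R :=
  let p j := graph_pt f (part_pt c d s j) in
  \sum_(0 <= j < size s) euclid_dist (p j) (p j.+1).

(* X j is the intersection point of the tangents at x_j and x_(j+1). *)
Definition tangent_measure (R : realType) (f : R -> R) (c d : R) (s : seq R)
    (X : nat -> R * R) : R :=
  let p j := graph_pt f (part_pt c d s j) in
  \sum_(0 <= j < size s)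
    (euclid_dist (p j) (X j) + euclid_dist (X j) (p j.+1)).

Definition secant_measures (R : realType) (f : R -> R) (a b c d : R) : set R :=
  [set S | exists2 s, admissible f a b c d s & S = secant_measure f c d s].

Definition tangent_measures (R : realType) (f : R -> R) (a b c d : R) : set R :=
  [set T | exists s (X : nat -> R * R),
    [/\ admissible f a b c d s,
        forall j, (j < size s)%N ->
          is_tangent_intersection f a b
            (part_pt c d s j) (part_pt c d s j.+1) (X j) &
        T = tangent_measure f c d s X]].

(* Length of the graph over [c, d]: supremum of the lengths of all inscribed
   polygons, with no condition on the tangents. *)
Definition arc_length (R : realType) (f : R -> R) (c d : R) : \bar R :=
  ereal_sup [set (secant_measure f c d s)%:E | s in itv_partition c d].

(* Main.v *)
(* Reflecting in the x-axis, we may take f convex. Over a piece [u, v] of a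
   tangent polygon every secant vector is a nonnegative combination of the two
   tangent directions, so its length is at most a linear form of it, which takes
   the value t on the whole chord. Gluing these forms gives a function G whose
   increments dominate all secant lengths and whose total increment is T(Omega):
   hence every inscribed polygon, with any vertices, is at most T(Omega) long.
   Conversely t - s <= 2 (m (v - u) - (f v - f u)) when v has tangent slope m,
   and symmetrically at u. For interior pieces this is at most
   2 (m_v - m_u) (v - u), so bisection makes T - S small; the first and the last
   piece, whose outer tangent may be vertical, are handled by continuity of f. *)

Require Import Defs.
From mathcomp Require Import all_boot all_order all_algebra.
From mathcomp Require Import all_classical all_reals all_analysis.
From mathcomp Require Import ring lra.

Set Implicit Arguments.
Unset Strict Implicit.
Unset Printing Implicit Defensive.

Import Order.TTheory GRing.Theory Num.Theory.
Import numFieldNormedType.Exports.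

Local Open Scope classical_set_scope.
Local Open Scope ring_scope.

(** * Euclidean length in the plane and cones spanned by two directions *)

Definition hypot {R : realType} (x y : R) : R := Num.sqrt (x ^+ 2 + y ^+ 2).

Lemma hypot_ge0 (R : realType) (x y : R) : 0 <= hypot x y.
Proof. exact: sqrtr_ge0. Qed.

Lemma sqr_hypot (R : realType) (x y : R) : hypot x y ^+ 2 = x ^+ 2 + y ^+ 2.
Proof. by rewrite sqr_sqrtr// addr_ge0// sqr_ge0. Qed.

Lemma hypot0l (R : realType) (y : R) : hypot 0 y = `|y|.
Proof. by rewrite /hypot expr0n add0r sqrtr_sqr. Qed.

Lemma hypotZ (R : realType) (k x y : R) :
  0 <= k -> hypot (k * x) (k * y) = k * hypot x y.
Proof.
move=> k0; rewrite /hypot !exprMn -mulrDr sqrtrM ?sqr_ge0// sqrtr_sqr.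
by rewrite ger0_norm.
Qed.

Lemma hypotD (R : realType) (x1 y1 x2 y2 : R) :
  hypot (x1 + x2) (y1 + y2) <= hypot x1 y1 + hypot x2 y2.
Proof.
have h1 := hypot_ge0 x1 y1; have h2 := hypot_ge0 x2 y2.
have e1 := sqr_hypot x1 y1; have e2 := sqr_hypot x2 y2.
have CS : x1 * x2 + y1 * y2 <= hypot x1 y1 * hypot x2 y2.
  apply: le_trans (ler_norm _) _.
  rewrite -(@ler_pXn2r _ 2)// ?nnegrE ?mulr_ge0// exprMn e1 e2 real_normK ?num_real//.
  (* Lagrange's identity: this square is the difference of the two sides. *)
  have := sqr_ge0 (x1 * y2 - x2 * y1); lra.
rewrite -(@ler_pXn2r _ 2)// ?nnegrE ?addr_ge0 ?hypot_ge0//.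
rewrite sqr_hypot [leRHS]sqrrD e1 e2; lra.
Qed.

Lemma euclid_distE (R : realType) (P Q : R * R) :
  euclid_dist P Q = hypot (Q.1 - P.1) (Q.2 - P.2).
Proof. by []. Qed.

Lemma euclid_dist_triangle (R : realType) (P Q M : R * R) :
  euclid_dist P Q <= euclid_dist P M + euclid_dist M Q.
Proof.
rewrite !euclid_distE.
have -> : Q.1 - P.1 = (M.1 - P.1) + (Q.1 - M.1) by ring.
have -> : Q.2 - P.2 = (M.2 - P.2) + (Q.2 - M.2) by ring.
exact: hypotD.
Qed.

Lemma euclid_distC (R : realType) (P Q : R * R) :
  euclid_dist P Q = euclid_dist Q P.
Proof. by rewrite /euclid_dist -[in LHS]sqrrN -[X in _ + X]sqrrN !opprB. Qed.

(** The plane determinant; its sign tells on which side of [e] the vector [w] lies. *)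
Definition cross {R : realType} (e w : R * R) : R := e.1 * w.2 - e.2 * w.1.

(* The right-hand side is the sum of the lengths of the two components of [w] on
   the basis [e1], [e2] (Cramer's rule). *)
Lemma hypot_le_cone (R : realType) (e1 e2 w : R * R) : 0 < cross e1 e2 ->
  0 <= cross w e2 -> 0 <= cross e1 w ->
  hypot w.1 w.2 <= cross w e2 / cross e1 e2 * hypot e1.1 e1.2
                 + cross e1 w / cross e1 e2 * hypot e2.1 e2.2.
Proof.
move=> D0 w1 w2; rewrite -!hypotZ ?divr_ge0 ?(ltW D0)//.
apply: le_trans (hypotD _ _ _ _); rewrite le_eqVlt; apply/orP; left; apply/eqP.
move: D0; rewrite /cross => D0.
by congr hypot; field; apply/eqP => /eqP; rewrite gt_eqF.
Qed.

(** The chord [q - p] is [k e1 + l e2], and uniqueness of this decomposition identifies [P - p] with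
    [k e1] and [q - P] with [l e2]. The bound of [hypot_le_cone] is linear in [w]; written with
    coefficients [A] and [B], its value on the whole chord is the length of the detour through
    [P]. *)
Lemma tangent_triangle (R : realType) (p q P e1 e2 : R * R) :
  0 < cross e1 e2 -> 0 <= e1.1 -> 0 <= e2.1 ->
  cross e1 (P.1 - p.1, P.2 - p.2) = 0 -> cross e2 (q.1 - P.1, q.2 - P.2) = 0 ->
  0 <= cross (q.1 - p.1, q.2 - p.2) e2 -> 0 <= cross e1 (q.1 - p.1, q.2 - p.2) ->
  p.1 <= P.1 <= q.1 /\ exists A B : R,
  (forall w, 0 <= cross w e2 -> 0 <= cross e1 w ->
     hypot w.1 w.2 <= A * w.1 + B * w.2) /\
  euclid_dist p P + euclid_dist P q = A * (q.1 - p.1) + B * (q.2 - p.2).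
Proof.
move=> D0 x1 x2 c1 c2 k1 k2.
have D' : cross e1 e2 != 0 by rewrite gt_eqF.
pose k := cross (q.1 - p.1, q.2 - p.2) e2 / cross e1 e2.
pose l := cross e1 (q.1 - p.1, q.2 - p.2) / cross e1 e2.
have k0 : 0 <= k by rewrite divr_ge0// ltW.
have l0 : 0 <= l by rewrite divr_ge0// ltW.
have E1 : P.1 - p.1 = k * e1.1.
  apply: (mulIf D'); rewrite mulrAC divfK//; move: c1 c2; rewrite /cross/= => c1 c2.
  have := congr1 ( *%R e2.1) c1; have := congr1 ( *%R e1.1) c2; lra.
have E2 : P.2 - p.2 = k * e1.2.
  apply: (mulIf D'); rewrite mulrAC divfK//; move: c1 c2; rewrite /cross/= => c1 c2.
  have := congr1 ( *%R e2.2) c1; have := congr1 ( *%R e1.2) c2; lra.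
have F1 : q.1 - P.1 = l * e2.1.
  apply: (mulIf D'); rewrite mulrAC divfK//; move: c1 c2; rewrite /cross/= => c1 c2.
  have := congr1 ( *%R e2.1) c1; have := congr1 ( *%R e1.1) c2; lra.
have F2 : q.2 - P.2 = l * e2.2.
  apply: (mulIf D'); rewrite mulrAC divfK//; move: c1 c2; rewrite /cross/= => c1 c2.
  have := congr1 ( *%R e2.2) c1; have := congr1 ( *%R e1.2) c2; lra.
split.
  by apply/andP; split; rewrite -subr_ge0 ?E1 ?F1 mulr_ge0.
pose h1 := hypot e1.1 e1.2; pose h2 := hypot e2.1 e2.2.
exists ((e2.2 * h1 - e1.2 * h2) / cross e1 e2),
       ((e1.1 * h2 - e2.1 * h1) / cross e1 e2).
have lin w : (e2.2 * h1 - e1.2 * h2) / cross e1 e2 * w.1 +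
    (e1.1 * h2 - e2.1 * h1) / cross e1 e2 * w.2 =
    cross w e2 / cross e1 e2 * h1 + cross e1 w / cross e1 e2 * h2.
  by rewrite [cross w _]/cross [cross _ w]/cross; field.
split=> [w w1 w2|]; first by rewrite lin; exact: hypot_le_cone.
rewrite (lin (q.1 - p.1, q.2 - p.2)) !euclid_distE E1 E2 F1 F2 !hypotZ//.
Qed.

(** * Convexity, chord slopes and tangent slopes *)

(* For [y < u] the point [u + k (y - u)] lies to the left of [u], so this single
   inequality serves for slopes on both sides. *)
Definition below_chords {R : realType} (f : R -> R) (c d : R) : Prop :=
  forall u y k, c <= u <= d -> c <= y <= d -> 0 <= k <= 1 ->
    f (u + k * (y - u)) - f u <= k * (f y - f u).

Lemma convex_function_below_chords (R : realType) (f : R -> R) (c d : R) :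
  @convex_function R R^o `[c, d] f -> below_chords f c d.
Proof.
move=> cf u y k uI yI /andP[k0 k1].
have : f (k * y + (1 - k) * u) <= k * f y + (1 - k) * f u.
  by apply: (cf (Itv01 k0 k1) y u); rewrite inE/= in_itv.
have -> : k * y + (1 - k) * u = u + k * (y - u) by ring.
lra.
Qed.

(** Convexity at [y = x + k (z - x)], cleared of denominators so that the coincidences [x = y] and
    [y = z] stay allowed. *)
Lemma three_slopes (R : realType) (f : R -> R) (c d x y z : R) :
  below_chords f c d -> c <= x -> x <= y -> y <= z -> z <= d ->
  (f y - f x) * (z - y) <= (f z - f y) * (y - x).
Proof.
move=> cf cx xy yz zd; have [->|nxy] := eqVneq x y.
  by rewrite !subrr mul0r mulr0.
have xy' : x < y by rewrite lt_neqAle nxy.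
have zx : 0 < z - x by lra.
pose k := (y - x) / (z - x).
have kE : k * (z - x) = y - x by rewrite /k divfK// gt_eqF.
have := cf x z k; rewrite kE.
have -> : x + (y - x) = y by ring.
have -> : 0 <= k <= 1.
  apply/andP; split; first by rewrite divr_ge0; lra.
  by rewrite ler_pdivrMr//; lra.
have -> : c <= x <= d by lra.
have -> : c <= z <= d by lra.
move=> /(_ erefl erefl erefl).
rewrite -(ler_pM2r zx) mulrAC kE; lra.
Qed.

Lemma within_dnbhsP (R : realType) (a b x : R) (Q : R -> Prop) :
  (\forall y \near within `[a, b] x^', Q y) ->
  exists2 e, 0 < e &
    forall y, a <= y <= b -> y != x -> `|y - x| < e -> Q y.
Proof.
rewrite !near_withinE => /nbhs_ballP[e /= e0 h]; exists e => // y yab yx yxe.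
by apply: h; rewrite //= /ball/= distrC.
Qed.

(** Convexity compares the increment at [y] with that at [z = u + k (y - u)]. For small [k] the
    secant slope at [z] is close to [m]; dividing by [k] returns to [y]. *)
Lemma tangent_support (R : realType) (f : R -> R) (a b c d u m : R) :
  below_chords f c d -> a <= c -> d <= b -> c <= u <= d ->
  secant_slope f u y @[y --> within `[a, b] u^'] --> m ->
  forall y, c <= y <= d -> m * (y - u) <= f y - f u.
Proof.
move=> cf ac db uI /cvgrPdist_lt hm y yI.
have [->|yu] := eqVneq y u; first by rewrite !subrr mulr0.
have yu0 : 0 < `|y - u| by rewrite normr_gt0 subr_eq0.
apply/ler_addgt0Pr => e e0.
(* The tolerance is scaled so that the error in [f z - f u] is at most [k * e]. *)
have [//|r r0 hr] := within_dnbhsP (hm (e / `|y - u|) _); first by rewrite divr_gt0.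
pose k := Num.min 1 (r / 2 / `|y - u|).
have k0 : 0 < k by rewrite lt_min ltr01 !divr_gt0.
have k1 : k <= 1 by rewrite ge_min lexx.
have kr : k * `|y - u| <= r / 2 by rewrite -ler_pdivlMr// ge_min lexx orbT.
have := cf u y k uI yI; rewrite (ltW k0) k1 => /(_ erefl) cfk.
set z := u + k * (y - u) in cfk.
have zu : z - u = k * (y - u) by rewrite /z; ring.
have := hr z; rewrite zu normrM (gtr0_norm k0).
have -> : a <= z <= b.
  have p1 : 0 <= k * (y - c) by apply: mulr_ge0; lra.
  have p2 : 0 <= k * (d - y) by apply: mulr_ge0; lra.
  have p3 : 0 <= (1 - k) * (u - c) by apply: mulr_ge0; lra.
  have p4 : 0 <= (1 - k) * (d - u) by apply: mulr_ge0; lra.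
  rewrite /z; lra.
have -> : z != u by rewrite -subr_eq0 zu mulf_neq0 ?subr_eq0// gt_eqF.
have -> : k * `|y - u| < r by lra.
move=> /(_ erefl erefl erefl); rewrite /secant_slope zu => hz.
have kyu : 0 < `|k * (y - u)| by rewrite normrM mulr_gt0// gtr0_norm.
have : (m - (f z - f u) / (k * (y - u))) * (k * (y - u)) <= k * e.
  apply: le_trans (ler_norm _) _; rewrite normrM.
  apply: le_trans (ler_wpM2r (normr_ge0 _) (ltW hz)) _.
  by rewrite normrM (gtr0_norm k0) mulrCA divfK// gt_eqF.
rewrite mulrBl divfK ?mulf_neq0 ?subr_eq0 ?(gt_eqF k0)// => h.
rewrite -(ler_pM2l k0); lra.
Qed.

(** Chord slopes to the right of an interior point [u] lie between those of the chords over [[c, u]]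
    and [[u, d]], hence stay bounded. *)
Lemma no_vertical_tangent_inside (R : realType) (f : R -> R) (a b c d u : R) :
  below_chords f c d -> a <= c -> d <= b -> c < u < d ->
  ~ ((`|secant_slope f u y| : R) @[y --> within `[a, b] u^'] --> +oo).
Proof.
move=> cf ac db uI /cvgryPgt hm.
pose s1 := (f u - f c) / (u - c); pose s2 := (f d - f u) / (d - u).
have [r r0 hr] := within_dnbhsP (hm (`|s1| + `|s2|)).
pose z := Num.min d (u + r / 2).
have zu : u < z by rewrite lt_min; lra.
have zd : z <= d by rewrite ge_min lexx.
have zr : z <= u + r / 2 by rewrite ge_min lexx orbT.
have := hr z.
have -> : a <= z <= b by lra.
have -> : z != u by rewrite gt_eqF.
have -> : `|z - u| < r by rewrite gtr0_norm; lra.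
move=> /(_ erefl erefl erefl); rewrite /secant_slope.
have h1 := three_slopes cf (lexx c) (ltac:(lra) : c <= u) (ltW zu) zd.
have h2 := three_slopes cf (ltac:(lra) : c <= u) (ltW zu) zd (lexx d).
have uc0 : 0 < u - c by lra.
have du0 : 0 < d - u by lra.
have zu0 : 0 < z - u by lra.
have e1 : s1 <= (f z - f u) / (z - u).
  rewrite /s1 ler_pdivrMr// mulrAC ler_pdivlMr//.
have e2 : (f z - f u) / (z - u) <= s2.
  rewrite /s2 ler_pdivrMr// mulrAC ler_pdivlMr//; lra.
have := ler_norm s2; have := ler_norm (- s1); rewrite normrN => n1 n2.
have := normr_ge0 s1; have := normr_ge0 s2 => ? ? h.
have : `|(f z - f u) / (z - u)| <= `|s1| + `|s2|.
  by rewrite ler_norml; apply/andP; split; lra.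
by rewrite leNgt h.
Qed.

(** * Secants and tangents over a single piece *)

Lemma hypotZ1 (R : realType) (k m : R) :
  0 <= k -> hypot k (k * m) = k * hypot 1 m.
Proof. by move=> k0; rewrite -hypotZ// mulr1. Qed.

(** The chord over [[u, x]] has slope at least [m], and the next chord, over [[x, y]], has no
    smaller slope. *)
Lemma support_secant_ge (R : realType) (f : R -> R) (c d u m x y : R) :
  below_chords f c d -> c <= u -> u <= x -> x <= y -> y <= d ->
  (forall z, c <= z <= d -> m * (z - u) <= f z - f u) ->
  m * (y - x) <= f y - f x.
Proof.
move=> cf cu ux xy yd hm; have [->|nux] := eqVneq x u.
  by apply: hm; lra.
have ux' : 0 < x - u by rewrite subr_gt0 lt_neqAle eq_sym nux.
have h1 := three_slopes cf cu ux xy yd.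
have h2 : m * (x - u) * (y - x) <= (f x - f u) * (y - x).
  by apply: ler_wpM2r; [lra|apply: hm; lra].
rewrite -(ler_pM2r ux'); lra.
Qed.

Lemma support_secant_le (R : realType) (f : R -> R) (c d v m x y : R) :
  below_chords f c d -> c <= x -> x <= y -> y <= v -> v <= d ->
  (forall z, c <= z <= d -> m * (z - v) <= f z - f v) ->
  f y - f x <= m * (y - x).
Proof.
move=> cf cx xy yv vd hm; have [->|nyv] := eqVneq y v.
  by have := hm x (ltac:(lra) : c <= x <= d); lra.
have yv' : 0 < v - y by rewrite subr_gt0 lt_neqAle nyv.
have h1 := three_slopes cf cx xy yv vd.
have h2 : (f v - f y) * (y - x) <= m * (v - y) * (y - x).
  apply: ler_wpM2r; first by lra.
  by have := hm y (ltac:(lra) : c <= y <= d); lra.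
rewrite -(ler_pM2r yv'); lra.
Qed.

(** [M] is the point of the chord with the abscissa of [P]. Each leg exceeds its share of the chord
    by at most the vertical distance from [M] to [P]. *)
Lemma chord_detour (R : realType) (p q P : R * R) (k : R) : 0 <= k <= 1 ->
  P.1 - p.1 = k * (q.1 - p.1) ->
  euclid_dist p P + euclid_dist P q
    <= euclid_dist p q + `|P.2 - p.2 - k * (q.2 - p.2)| *+ 2.
Proof.
move=> /andP[k0 k1] kE.
pose M : R * R := (P.1, p.2 + k * (q.2 - p.2)).
have PM : euclid_dist P M = `|P.2 - p.2 - k * (q.2 - p.2)|.
  by rewrite euclid_distE /= subrr hypot0l distrC opprD addrA.
have MP : euclid_dist M P = `|P.2 - p.2 - k * (q.2 - p.2)|.
  by rewrite euclid_distC PM.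
have pM : euclid_dist p M = k * euclid_dist p q.
  rewrite !euclid_distE /= -hypotZ// kE; congr hypot; ring.
have Mq : euclid_dist M q = (1 - k) * euclid_dist p q.
  rewrite !euclid_distE /= -hypotZ; last by rewrite subr_ge0.
  congr hypot; last by ring.
  by rewrite mulrBl mul1r -kE; ring.
have := euclid_dist_triangle p P M; have := euclid_dist_triangle P q M.
rewrite pM Mq PM MP; lra.
Qed.

(** The tangent directions serve as [e1] and [e2] in [tangent_triangle]; the support inequalities
    put every secant vector of the piece into their cone. *)
Lemma tangent_piece (R : realType) (f : R -> R) (a b c d u v : R) (P : R * R) :
  below_chords f c d -> a <= c -> d <= b -> c <= u -> u < v -> v <= d ->
  is_tangent_intersection f a b u v P ->
  u <= P.1 <= v /\ exists A B : R,
  (forall x y, u <= x -> x < y -> y <= v ->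
    euclid_dist (graph_pt f x) (graph_pt f y) <= A * (y - x) + B * (f y - f x)) /\
  euclid_dist (graph_pt f u) P + euclid_dist P (graph_pt f v)
    = A * (v - u) + B * (f v - f u).
Proof.
move=> cf ac db cu uv vd [l [l' [tl tl' lP lP' eqP]]].
have uI : c <= u <= d by lra.
have vI : c <= v <= d by lra.
have cone (e1 e2 : R * R) : 0 < cross e1 e2 -> 0 <= e1.1 -> 0 <= e2.1 ->
    cross e1 (P.1 - u, P.2 - f u) = 0 -> cross e2 (v - P.1, f v - P.2) = 0 ->
    (forall x y, u <= x -> x < y -> y <= v ->
      0 <= cross (y - x, f y - f x) e2 /\ 0 <= cross e1 (y - x, f y - f x)) ->
  u <= P.1 <= v /\ exists A B : R,
  (forall x y, u <= x -> x < y -> y <= v ->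
    euclid_dist (graph_pt f x) (graph_pt f y) <= A * (y - x) + B * (f y - f x)) /\
  euclid_dist (graph_pt f u) P + euclid_dist P (graph_pt f v)
    = A * (v - u) + B * (f v - f u).
  move=> D0 x1 x2 c1 c2 sec.
  have [s1 s2] := sec _ _ (lexx u) uv (lexx v).
  have [PI [A [B [hAB tE]]]] :=
    @tangent_triangle R (graph_pt f u) (graph_pt f v) P e1 e2 D0 x1 x2 c1 c2 s1 s2.
  split=> //; exists A, B; split=> // x y ux xy yv.
  by have [t1 t2] := sec _ _ ux xy yv; exact: (hAB (y - x, f y - f x)).
case: tl tl' => [[m hm lE]|[_ lE]] [[m' hm' lE']|[_ lE']].
- have sm := tangent_support cf ac db uI hm.
  have sm' := tangent_support cf ac db vI hm'.
  have sec x y : u <= x -> x < y -> y <= v ->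
      m * (y - x) <= f y - f x <= m' * (y - x).
    move=> ux xy yv; apply/andP; split.
      by apply: (support_secant_ge cf _ ux _ _ sm); lra.
    by apply: (support_secant_le cf _ _ yv _ sm'); lra.
  have mm' : m <= m'.
    have vu0 : 0 < v - u by lra.
    by rewrite -(ler_pM2r vu0); have := sec _ _ (lexx u) uv (lexx v); lra.
  (* Equal slopes leave no cone, but then [f] is affine on the piece and the form with
     [A = hypot 1 m], [B = 0] is exact. *)
  have [mm|nmm] := eqVneq m m'.
    rewrite -{m' hm' mm' lE'}mm in sm' sec lE' *.
    have fv : f v - f u = m * (v - u).
      by have := sec _ _ (lexx u) uv (lexx v); lra.
    have ll' : l = l'.
      by rewrite lE lE'; apply/seteqP; split=> Q /= ->; lra.
    have [PI PE] := eqP ll'; split=> //; exists (hypot 1 m), 0; split.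
      move=> x y ux xy yv; rewrite mul0r addr0 euclid_distE /=.
      have -> : f y - f x = (y - x) * m by have := sec _ _ ux xy yv; lra.
      by rewrite hypotZ1 1?mulrC// subr_ge0 ltW.
    rewrite mul0r addr0 !euclid_distE /=.
    move: lP lP'; rewrite lE lE' /= => P2 P2'.
    have -> : P.2 - f u = (P.1 - u) * m by lra.
    have -> : f v - P.2 = (v - P.1) * m by lra.
    rewrite !hypotZ1; lra.
  have mlt : m < m' by rewrite lt_neqAle nmm.
  move: lP lP'; rewrite lE lE' /= => P2 P2'.
  apply: (cone (1, m) (1, m')); rewrite /cross/=; try lra.
  by move=> x y ux xy yv; have := sec _ _ ux xy yv; lra.
- have sm := tangent_support cf ac db uI hm.
  move: lP lP'; rewrite lE lE' /= => P2 P2'.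
  apply: (cone (1, m) (0, 1)); rewrite /cross/=; try lra.
  move=> x y ux xy yv.
  have := support_secant_ge cf cu ux (ltW xy) (le_trans yv vd) sm; lra.
- have sm' := tangent_support cf ac db vI hm'.
  move: lP lP'; rewrite lE lE' /= => P2 P2'.
  (* A vertical tangent is oriented downwards at the left end and upwards at the right end, which
     makes the determinant positive. *)
  apply: (cone (0, -1) (1, m')); rewrite /cross/=; try lra.
  move=> x y ux xy yv.
  have := support_secant_le cf (le_trans cu ux) (ltW xy) yv vd sm'; lra.
- move: lP lP'; rewrite lE lE' /=; lra.
Qed.

(** * Intersection points and the excess of tangents over the chord *)

(** With an endpoint inside []c, d[], at most one of the tangents is vertical. Two tangents of equal
    finite slope both support [f], hence coincide. *)
Lemma tangents_intersect (R : realType) (f : R -> R) (a b c d u v : R) l l' :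
  below_chords f c d -> a <= c -> d <= b -> c <= u -> u < v -> v <= d ->
  c < u \/ v < d -> is_tangent_line f a b u l -> is_tangent_line f a b v l' ->
  exists P, [/\ l P, l' P & is_tangent_intersection f a b u v P].
Proof.
move=> cf ac db cu uv vd inner tl tl'.
have uI : c <= u <= d by lra.
have vI : c <= v <= d by lra.
suff [P [lP lP']] : exists P, l P /\ l' P.
  (* For coincident tangents the point must lie on the graph; the left endpoint is taken. *)
  have [ll|ll] := pselect (l = l'); last by exists P; split=> //; exists l, l'.
  have lu : l (graph_pt f u).
    by case: tl => -[m]; [move=> _ ->|move=> ->] => //=; rewrite subrr mulr0 addr0.
  exists (graph_pt f u); rewrite -ll; split=> //; exists l, l'; split=> //.
    by rewrite -ll.
  by move=> _ /=; split=> //; lra.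
case: tl tl' => [[m hm ->]|[hm ->]] [[m' hm' ->]|[hm' ->]] /=.
- have sm := tangent_support cf ac db uI hm vI.
  have sm' := tangent_support cf ac db vI hm' uI.
  have [mm|nmm] := eqVneq m m'.
    rewrite -{m' hm'}mm in sm' *.
    by exists (graph_pt f u) => /=; lra.
  have nmm' : m' - m != 0 by rewrite subr_eq0 eq_sym.
  (* The abscissa solving [f u + m (k - u) = f v + m' (k - v)]. *)
  pose k := (f u - f v + m' * v - m * u) / (m' - m).
  have kE : k * (m' - m) = f u - f v + m' * v - m * u by rewrite divfK.
  by exists (k, f u + m * (k - u)) => /=; lra.
- by exists (v, f u + m * (v - u)).
- by exists (u, f v + m' * (u - v)).
- have := no_vertical_tangent_inside cf ac db _ hm.
  have := no_vertical_tangent_inside cf ac db _ hm'.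
  by move=> h1 h2; case: inner => ?; exfalso; [apply: h2|apply: h1]; lra.
Qed.

(** As [P] lies on the tangent at [v], its vertical distance to the chord is [1 - k] times
    [m (v - u) - (f v - f u)], and [chord_detour] doubles it. The tangent at [u] may be vertical. *)
Lemma tangent_gap_right (R : realType) (f : R -> R) (a b c d u v m : R) :
  below_chords f c d -> a <= c -> d <= b -> is_curve f a b ->
  c <= u -> u < v -> v < d ->
  secant_slope f v y @[y --> within `[a, b] v^'] --> m ->
  exists P, is_tangent_intersection f a b u v P /\
    euclid_dist (graph_pt f u) P + euclid_dist P (graph_pt f v)
    <= euclid_dist (graph_pt f u) (graph_pt f v)
       + (m * (v - u) - (f v - f u)) *+ 2.
Proof.
move=> cf ac db [_ _ tgt] cu uv vd hm.
have vI : c <= v <= d by lra.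
have uI : c <= u <= d by lra.
have [|l tl] := tgt u; first by rewrite in_itv/=; lra.
have tl' : is_tangent_line f a b v [set P : R * R | P.2 = f v + m * (P.1 - v)].
  by left; exists m.
have [P [_ /= P2 PT]] :=
  tangents_intersect cf ac db cu uv (ltW vd) (or_intror vd) tl tl'.
exists P; split=> //.
have [PI _] := tangent_piece cf ac db cu uv (ltW vd) PT.
have sm := tangent_support cf ac db vI hm uI.
have vu0 : 0 < v - u by lra.
pose k := (P.1 - u) / (v - u).
have kE : k * (v - u) = P.1 - u by rewrite divfK// gt_eqF.
have kI : 0 <= k <= 1.
  apply/andP; split; first by rewrite divr_ge0//; lra.
  by rewrite ler_pdivrMr//; lra.
apply: le_trans (chord_detour (p := graph_pt f u) (q := graph_pt f v) kI _) _.
  by rewrite kE.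
rewrite lerD2l lerMn2r /= ler_norml P2.
have p1 : 0 <= k * (m * (v - u) - (f v - f u)) by apply: mulr_ge0; lra.
have p2 : 0 <= (1 - k) * (m * (v - u) - (f v - f u)) by apply: mulr_ge0; lra.
have e1 : m * (P.1 - v) = m * (k * (v - u) - (v - u)) by rewrite kE; ring.
rewrite e1; lra.
Qed.

(** Mirror image of [tangent_gap_right]: [P] lies on the tangent at [u], the factor is [k], and the
    tangent at [v] may be vertical. *)
Lemma tangent_gap_left (R : realType) (f : R -> R) (a b c d u v m : R) :
  below_chords f c d -> a <= c -> d <= b -> is_curve f a b ->
  c < u -> u < v -> v <= d ->
  secant_slope f u y @[y --> within `[a, b] u^'] --> m ->
  exists P, is_tangent_intersection f a b u v P /\
    euclid_dist (graph_pt f u) P + euclid_dist P (graph_pt f v)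
    <= euclid_dist (graph_pt f u) (graph_pt f v)
       + ((f v - f u) - m * (v - u)) *+ 2.
Proof.
move=> cf ac db [_ _ tgt] cu uv vd hm.
have vI : c <= v <= d by lra.
have uI : c <= u <= d by lra.
have [|l tl] := tgt v; first by rewrite in_itv/=; lra.
have tl' : is_tangent_line f a b u [set P : R * R | P.2 = f u + m * (P.1 - u)].
  by left; exists m.
have [P [/= P2 _ PT]] :=
  tangents_intersect cf ac db (ltW cu) uv vd (or_introl cu) tl' tl.
exists P; split=> //.
have [PI _] := tangent_piece cf ac db (ltW cu) uv vd PT.
have sm := tangent_support cf ac db uI hm vI.
have vu0 : 0 < v - u by lra.
pose k := (P.1 - u) / (v - u).
have kE : k * (v - u) = P.1 - u by rewrite divfK// gt_eqF.
have kI : 0 <= k <= 1.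
  apply/andP; split; first by rewrite divr_ge0//; lra.
  by rewrite ler_pdivrMr//; lra.
apply: le_trans (chord_detour (p := graph_pt f u) (q := graph_pt f v) kI _) _.
  by rewrite kE.
rewrite lerD2l lerMn2r /= ler_norml P2 -kE.
have p1 : 0 <= k * (f v - f u - m * (v - u)) by apply: mulr_ge0; lra.
have p2 : 0 <= (1 - k) * (f v - f u - m * (v - u)) by apply: mulr_ge0; lra.
lra.
Qed.

Lemma interior_slope (R : realType) (f : R -> R) (a b c d x : R) :
  below_chords f c d -> a <= c -> d <= b -> is_curve f a b -> c < x < d ->
  exists m : R, secant_slope f x y @[y --> within `[a, b] x^'] --> m.
Proof.
move=> cf ac db [_ _ tgt] xI; have [|l] := tgt x; first by rewrite in_itv/=; lra.
case=> [[m hm _]|[hm _]]; first by exists m.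
by have := no_vertical_tangent_inside cf ac db xI hm.
Qed.

(** * Recursion along a partition *)

Lemma secant_measure_cons (R : realType) (f : R -> R) (u v x : R) s :
  secant_measure f u v (x :: s) =
  euclid_dist (graph_pt f u) (graph_pt f x) + secant_measure f x v s.
Proof. by rewrite /secant_measure /= big_nat_recl. Qed.

Lemma tangent_measure_cons (R : realType) (f : R -> R) (u v x : R) s X :
  tangent_measure f u v (x :: s) X =
  euclid_dist (graph_pt f u) (X 0%N) + euclid_dist (X 0%N) (graph_pt f x)
  + tangent_measure f x v s (X \o S).
Proof. by rewrite /tangent_measure /= big_nat_recl. Qed.

Definition tangent_polygon {R : realType} (f : R -> R) (a b u v : R) s X : Prop :=
  itv_partition u v s /\ forall j, (j < size s)%N ->
    is_tangent_intersection f a b (part_pt u v s j) (part_pt u v s j.+1) (X j).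

Lemma tangent_polygon_consP (R : realType) (f : R -> R) (a b u v x : R) s X :
  tangent_polygon f a b u v (x :: s) X <->
  [/\ u < x, is_tangent_intersection f a b u x (X 0%N) &
      tangent_polygon f a b x v s (X \o S)].
Proof.
split=> [[[/= /andP[ux ps] ls] h]|[ux h0 [[ps ls] h]]].
  split=> //; first exact: (h 0%N).
  by split=> // j js; exact: (h j.+1).
split; first by split=> //=; rewrite ux.
by case=> [_|j js] //; exact: h.
Qed.

Lemma tangent_polygon_admissible (R : realType) (f : R -> R) (a b c d : R) s X :
  tangent_polygon f a b c d s X -> admissible f a b c d s.
Proof.
move=> [ps h]; split=> // j /h[l [m [tl tm lP mP _]]].
by exists l, m; split=> //; exists (X j).
Qed.

(** * Tangent polygons dominate inscribed polygons *)

Definition majorizes {R : realType} (f G : R -> R) (u v : R) : Prop :=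
  forall x y, u <= x -> x < y -> y <= v ->
    euclid_dist (graph_pt f x) (graph_pt f y) <= G y - G x.

(** The second function is shifted to agree with the first at [w]; a chord straddling [w] is split
    there by the triangle inequality. *)
Lemma majorizes_cat (R : realType) (f G1 G2 : R -> R) (u w v : R) :
  majorizes f G1 u w -> majorizes f G2 w v ->
  majorizes f (fun z => if z <= w then G1 z else G2 z - G2 w + G1 w) u v.
Proof.
move=> h1 h2 x y ux xy yv; case: (leP y w) => yw.
  by rewrite (ltW (lt_le_trans xy yw)); exact: h1.
case: (leP x w) => xw; last by have := h2 _ _ (ltW xw) xy yv; lra.
have := h2 _ _ (lexx w) yw yv; have [->|nxw] := eqVneq x w; first by lra.
have xw' : x < w by rewrite lt_neqAle nxw.
have := h1 _ _ ux xw' (lexx w).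
have := euclid_dist_triangle (graph_pt f x) (graph_pt f y) (graph_pt f w); lra.
Qed.

Lemma secant_measure_majorized (R : realType) (f G : R -> R) (u v : R) s :
  majorizes f G u v -> itv_partition u v s ->
  secant_measure f u v s <= G v - G u.
Proof.
elim: s u => [|x s IH] u hG ps.
  by rewrite (itv_partition_nil ps) subrr /secant_measure big_geq.
have ux : u < x by case: ps => /andP[].
have ps' := itv_partition_cons ps; have xv := itv_partition_le ps'.
have hG' : majorizes f G x v.
  by move=> y z xy yz zv; apply: hG => //; exact: le_trans (ltW ux) xy.
have := IH _ hG' ps'; have := hG _ _ (lexx u) ux xv.
by rewrite secant_measure_cons; lra.
Qed.

(** On each piece the linear form of [tangent_piece], evaluated along the graph, is a majorant whose
    increment is the length of the two tangent legs. These are glued at the vertices. *)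
Lemma tangent_polygon_majorant (R : realType) (f : R -> R) (a b c d u v : R) s X :
  below_chords f c d -> a <= c -> d <= b -> c <= u -> v <= d ->
  tangent_polygon f a b u v s X ->
  exists G, majorizes f G u v /\ tangent_measure f u v s X = G v - G u.
Proof.
move=> cf ac db cu vd; elim: s u X cu => [|w s IH] u X cu.
  move=> [/itv_partition_nil <- _]; exists (fun=> 0).
  by split=> [x y|]; [lra|rewrite subrr /tangent_measure big_geq].
move=> /tangent_polygon_consP[uw PT tp].
have wv : w <= v by case: tp => /itv_partition_le.
have [G2 [hG2 GT]] := IH _ _ (le_trans cu (ltW uw)) tp.
have [_ [A [B [hAB tE]]]] := tangent_piece cf ac db cu uw (le_trans wv vd) PT.
have hG1 : majorizes f (fun z => A * z + B * f z) u w.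
  by move=> x y ux xy yw; have := hAB _ _ ux xy yw; lra.
eexists; split; first exact: majorizes_cat hG1 hG2.
rewrite tangent_measure_cons tE GT (ltW uw).
by case: (leP v w) => [vw|_]; [have -> : v = w by lra|]; lra.
Qed.

(** * Tangent polygons of arbitrarily small excess *)

Definition tangent_approx {R : realType} (f : R -> R) (a b u v e : R) : Prop :=
  exists s X, tangent_polygon f a b u v s X /\
    tangent_measure f u v s X <= secant_measure f u v s + e.

Lemma tangent_approx1 (R : realType) (f : R -> R) (a b u v e : R) P : u < v ->
  is_tangent_intersection f a b u v P ->
  euclid_dist (graph_pt f u) P + euclid_dist P (graph_pt f v)
    <= euclid_dist (graph_pt f u) (graph_pt f v) + e ->
  tangent_approx f a b u v e.
Proof.
move=> uv PT h; exists [:: v], (fun=> P); split.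
  by split; [exact: itv_partition1|case].
rewrite secant_measure_cons tangent_measure_cons.
by rewrite /secant_measure /tangent_measure !big_geq// !addr0.
Qed.

Lemma tangent_approx_cat (R : realType) (f : R -> R) (a b u w v e1 e2 : R) :
  tangent_approx f a b u w e1 -> tangent_approx f a b w v e2 ->
  tangent_approx f a b u v (e1 + e2).
Proof.
move=> [s [X [tp h]]] [s2 [X2 [tp2 h2]]].
elim: s u X e1 tp h => [|x s IH] u X e1.
  move=> [/itv_partition_nil -> _].
  rewrite /secant_measure /tangent_measure !big_geq// add0r => e10.
  exists s2, X2; split=> //; lra.
move=> /tangent_polygon_consP[ux PT tp].
rewrite tangent_measure_cons secant_measure_cons => h.
(* The tail is left with [e1] minus the excess of the first piece, so the induction runs over all
   [e1]. *)
have [|s' [X' [tp' h']]] := IH x _ (e1 +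
    euclid_dist (graph_pt f u) (graph_pt f x) -
    (euclid_dist (graph_pt f u) (X 0%N) + euclid_dist (X 0%N) (graph_pt f x))) tp.
  by lra.
exists (x :: s'), (fun j => if j is i.+1 then X' i else X 0%N).
split; first exact/tangent_polygon_consP.
by rewrite tangent_measure_cons secant_measure_cons; lra.
Qed.

(* The bound on a piece is a slope variation times a length: bisecting halves the
   length while the slope variations of the two halves add up. *)
Lemma tangent_approx_bisect (R : realType) (f : R -> R) (a b c d : R) (n : nat) :
  below_chords f c d -> a <= c -> d <= b -> is_curve f a b ->
  forall u v mu mv : R, c < u -> u < v -> v < d ->
  secant_slope f u y @[y --> within `[a, b] u^'] --> mu ->
  secant_slope f v y @[y --> within `[a, b] v^'] --> mv ->
  tangent_approx f a b u v ((mv - mu) * (v - u) *+ 2 / 2 ^+ n).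
Proof.
move=> cf ac db fc; elim: n => [|n IH] u v mu mv cu uv vd hu hv.
  have [P [PT Pt]] := tangent_gap_right cf ac db fc (ltW cu) uv vd hv.
  apply: (tangent_approx1 uv PT (le_trans Pt _)).
  rewrite expr0 divr1 lerD2l lerMn2r /=.
  have uI : c <= u <= d by lra.
  have := tangent_support cf ac db uI hu (ltac:(lra) : c <= v <= d); lra.
have [|m hm] := @interior_slope _ f a b c d ((u + v) / 2) cf ac db fc; first by lra.
have h1 := IH u ((u + v) / 2) _ _ cu ltac:(lra) ltac:(lra) hu hm.
have h2 := IH ((u + v) / 2) v _ _ ltac:(lra) ltac:(lra) vd hm hv.
have -> : (mv - mu) * (v - u) *+ 2 / 2 ^+ n.+1 =
    (m - mu) * ((u + v) / 2 - u) *+ 2 / 2 ^+ n +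
    (mv - m) * (v - (u + v) / 2) *+ 2 / 2 ^+ n.
  have n2 : (2 ^+ n : R) != 0 by rewrite expf_neq0.
  by rewrite exprS; field.
exact: tangent_approx_cat h1 h2.
Qed.

(** Short end pieces over [[c, v]] and [[u, d]] cost at most [4 e / 10] each, and bisecting [[v, u]]
    costs at most [e / 10]. *)
Lemma tangent_approx_small (R : realType) (f : R -> R) (a b c d e : R) :
  below_chords f c d -> a <= c -> c < d -> d <= b -> is_curve f a b -> 0 < e ->
  tangent_approx f a b c d e.
Proof.
move=> cf ac cd db fc e0.
pose w := (c + d) / 2; have wI : c <= w <= d by rewrite /w; lra.
have [|m hm] := @interior_slope _ f a b c d w cf ac db fc; first by rewrite /w; lra.
have sw := tangent_support cf ac db wI hm.
have /(continuous_within_itvP _ cd)[_ fc_ fd_] : {within `[c, d], continuous f}.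
  case: fc => _ + _; apply: continuous_subspaceW.
  by move=> x /=; rewrite !in_itv/=; lra.
(* Chosen so that [m] times a length up to [r] is at most [e / 10]; adding 1 covers [m = 0]. *)
pose r := e / 10 / (`|m| + 1).
have m1 : 0 < `|m| + 1 by rewrite ltr_wpDl.
have r0 : 0 < r by rewrite divr_gt0//; lra.
have rm : r * (`|m| + 1) = e / 10 by rewrite divfK// gt_eqF.
have mr x : 0 <= x -> x <= r -> `|m * x| <= e / 10.
  move=> x0 xr; rewrite normrM (ger0_norm x0).
  have h : `|m| * x <= `|m| * r by rewrite ler_wpM2l.
  lra.
have [v [cv vw vr hv]] : exists v, [/\ c < v, v < w, v - c <= r &
    `|f v - f c| <= e / 10].
  move/cvgrPdist_lt : fc_ => /(_ (e / 10))[|s /= s0 hs]; first by lra.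
  (* Within the continuity radius, at most [r], and small enough for [c + x] to stay left of the
     midpoint. *)
  pose x := Num.min (s / 2) (Num.min r ((d - c) / 4)).
  have x0 : 0 < x by rewrite !lt_min; lra.
  have xs : x <= s / 2 by rewrite ge_min lexx.
  have xr : x <= r by rewrite !ge_min lexx orbT.
  have xd : x <= (d - c) / 4 by rewrite !ge_min lexx !orbT.
  exists (c + x); split; rewrite /w; try lra.
  rewrite distrC ltW//; apply: hs => /=; last by lra.
  by rewrite distrC gtr0_norm; lra.
have [u [ud wu ur hu]] : exists u, [/\ u < d, w < u, d - u <= r &
    `|f d - f u| <= e / 10].
  move/cvgrPdist_lt : fd_ => /(_ (e / 10))[|s /= s0 hs]; first by lra.
  pose x := Num.min (s / 2) (Num.min r ((d - c) / 4)).
  have x0 : 0 < x by rewrite !lt_min; lra.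
  have xs : x <= s / 2 by rewrite ge_min lexx.
  have xr : x <= r by rewrite !ge_min lexx orbT.
  have xd : x <= (d - c) / 4 by rewrite !ge_min lexx !orbT.
  exists (d - x); split; rewrite /w; try lra.
  rewrite ltW//; apply: hs => /=; last by lra.
  by rewrite gtr0_norm; lra.
have [|mv hmv] := @interior_slope _ f a b c d v cf ac db fc; first by lra.
have [|mu hmu] := @interior_slope _ f a b c d u cf ac db fc; first by lra.
have vI : c <= v <= d by lra.
have uI : c <= u <= d by lra.
(* The midpoint slope bounds [mv] above and [mu] below however close [v] and [u] are to the ends, so
   the end estimates do not depend on slopes that may blow up there. *)
have mvm : mv <= m.
  have wv0 : 0 < w - v by lra.
  have := tangent_support cf ac db vI hmv wI; have := sw _ vI.
  by rewrite -[_ <= m](ler_pM2r wv0); lra.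
have mum : m <= mu.
  have uw0 : 0 < u - w by lra.
  have := tangent_support cf ac db uI hmu wI; have := sw _ uI.
  by rewrite -[m <= _](ler_pM2r uw0); lra.
have A1 : tangent_approx f a b c v (e / 10 *+ 4).
  have [P [PT Pt]] := tangent_gap_right cf ac db fc (lexx c) cv (ltac:(lra) : v < d) hmv.
  apply: (tangent_approx1 cv PT (le_trans Pt _)).
  have h : mv * (v - c) <= m * (v - c) by apply: ler_wpM2r; lra.
  have := mr _ (ltac:(lra) : 0 <= v - c) vr.
  by move: hv; rewrite !ler_norml; lra.
have A3 : tangent_approx f a b u d (e / 10 *+ 4).
  have [P [PT Pt]] := tangent_gap_left cf ac db fc (ltac:(lra) : c < u) ud (lexx d) hmu.
  apply: (tangent_approx1 ud PT (le_trans Pt _)).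
  have h : m * (d - u) <= mu * (d - u) by apply: ler_wpM2r; lra.
  have := mr _ (ltac:(lra) : 0 <= d - u) ur.
  by move: hu; rewrite !ler_norml; lra.
pose K := (mu - mv) * (u - v) *+ 2.
have K0 : 0 <= K by rewrite mulrn_wge0// mulr_ge0; lra.
(* The Archimedean property gives [K / (e / 10) < n], and [n < 2 ^ n]. *)
pose n := Num.bound (K / (e / 10)).
have A2 := tangent_approx_bisect n cf ac db fc
  (ltac:(lra) : c < v) (ltac:(lra) : v < u) (ltac:(lra) : u < d) hmv hmu.
have Kn : K / 2 ^+ n <= e / 10.
  have e10 : 0 < e / 10 by lra.
  rewrite ler_pdivrMr ?exprn_gt0// mulrC -ler_pdivrMr//.
  apply: le_trans (_ : n%:R <= _); last by rewrite -natrX ler_nat ltnW// ltn_expl.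
  by rewrite ltW// archi_boundP// divr_ge0// ltW.
have [s [X [tp h]]] := tangent_approx_cat A1 (tangent_approx_cat A2 A3).
by exists s, X; split=> //; rewrite -/K in h; lra.
Qed.

(** * The convex case *)

(** The arc length lies between [S] and [T] of any tangent polygon, so polygons with [T <= S + e]
    for every [e > 0] settle both equalities. *)
Lemma convex_measures (R : realType) (f : R -> R) (a b c d : R) :
  is_curve f a b -> a <= c -> c < d -> d <= b -> below_chords f c d ->
  ereal_sup [set S%:E | S in secant_measures f a b c d] = arc_length f c d /\
  ereal_inf [set T%:E | T in tangent_measures f a b c d] = arc_length f c d.
Proof.
move=> fc ac cd db cf.
have arc_le s X : tangent_polygon f a b c d s X ->
    (arc_length f c d <= (tangent_measure f c d s X)%:E)%E.
  move=> tp; apply: ge_ereal_sup => _ [s0 ps0 <-]; rewrite lee_fin.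
  have [G [hG ->]] := tangent_polygon_majorant cf ac db (lexx c) (lexx d) tp.
  exact: secant_measure_majorized.
split; apply/eqP; rewrite eq_le; apply/andP; split.
- apply: ereal_sup_le => _ [_ [s [ps _] ->] <-]; by exists s.
- apply/lee_addgt0Pr => e e0.
  have [s [X [tp h]]] := tangent_approx_small cf ac cd db fc e0.
  apply: (le_trans (arc_le _ _ tp)).
  apply: (@le_trans _ _ ((secant_measure f c d s)%:E + e%:E)%E).
    by rewrite -EFinD lee_fin.
  rewrite leeD2r//; apply: ereal_sup_ubound.
  exists (secant_measure f c d s) => //; exists s => //.
  exact: tangent_polygon_admissible tp.
- apply/lee_addgt0Pr => e e0.
  have [s [X [tp h]]] := tangent_approx_small cf ac cd db fc e0.
  apply: (@le_trans _ _ (tangent_measure f c d s X)%:E).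
    apply: ereal_inf_lbound; exists (tangent_measure f c d s X) => //.
    exists s, X; split=> //; first exact: tangent_polygon_admissible tp.
    by case: tp.
  apply: (@le_trans _ _ ((secant_measure f c d s)%:E + e%:E)%E).
    by rewrite -EFinD lee_fin.
  rewrite leeD2r//; apply: ereal_sup_ubound; exists s => //.
  by case: tp.
- apply: le_ereal_inf_tmp => _ [_ [s [X [[ps _] h ->]]] <-].
  by apply: arc_le; split.
Qed.

(** * Reflection in the x-axis and the concave case *)

Definition reflect {R : realType} (P : R * R) : R * R := (P.1, - P.2).

Lemma reflectK (R : realType) : involutive (@reflect R).
Proof. by case=> x y; rewrite /reflect/= opprK. Qed.

Lemma euclid_dist_reflect (R : realType) (P Q : R * R) :
  euclid_dist (reflect P) (reflect Q) = euclid_dist P Q.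
Proof. by rewrite /euclid_dist /= -opprD sqrrN. Qed.

Lemma secant_slopeN (R : realType) (f : R -> R) (x y : R) :
  secant_slope (\- f) x y = - secant_slope f x y.
Proof. by rewrite /secant_slope /= -mulNr; congr (_ / _); ring. Qed.

Lemma is_tangent_lineN (R : realType) (f : R -> R) (a b x : R) l :
  is_tangent_line f a b x l ->
  is_tangent_line (\- f) a b x (reflect @^-1` l).
Proof.
case=> [[m hm ->]|[hm ->]].
  left; exists (- m).
    under eq_fun do rewrite secant_slopeN.
    exact: cvgN.
  by apply/seteqP; split=> P /=; lra.
right; split=> //.
by under eq_fun do rewrite secant_slopeN normrN.
Qed.

Lemma is_curveN (R : realType) (f : R -> R) (a b : R) :
  is_curve f a b -> is_curve (\- f) a b.
Proof.
move=> [ab fc tgt]; split=> //; first by move=> x; apply: cvgN; exact: fc.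
by move=> x /tgt[l tl]; exists (reflect @^-1` l); exact: is_tangent_lineN.
Qed.

Lemma is_tangent_intersectionN (R : realType) (f : R -> R) (a b u v : R) P :
  is_tangent_intersection f a b u v P ->
  is_tangent_intersection (\- f) a b u v (reflect P).
Proof.
move=> [l [m [tl tm lP mP lm]]].
exists (reflect @^-1` l), (reflect @^-1` m).
split; [exact: is_tangent_lineN|exact: is_tangent_lineN|
  by rewrite /preimage/= reflectK|by rewrite /preimage/= reflectK|move=> e].
have [|PI PE] := lm; last by split; rewrite /= ?PE.
(* Since [reflect] is an involution, equality of the reflected lines gives back [l = m]. *)
apply/seteqP; split=> Q lQ; rewrite -(reflectK Q).
  by have : (reflect @^-1` m) (reflect Q) by rewrite -e /preimage/= reflectK.
by have : (reflect @^-1` l) (reflect Q) by rewrite e /preimage/= reflectK.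
Qed.

Lemma admissibleN (R : realType) (f : R -> R) (a b c d : R) s :
  admissible f a b c d s -> admissible (\- f) a b c d s.
Proof.
move=> [ps h]; split=> // j /h[l [m [tl tm [P [lP mP]]]]].
exists (reflect @^-1` l), (reflect @^-1` m).
split; [exact: is_tangent_lineN|exact: is_tangent_lineN|].
by exists (reflect P); split; rewrite /preimage/= reflectK.
Qed.

Lemma secant_measureN (R : realType) (f : R -> R) (c d : R) s :
  secant_measure (\- f) c d s = secant_measure f c d s.
Proof.
apply: eq_bigr => j _.
exact: (euclid_dist_reflect (graph_pt f _) (graph_pt f _)).
Qed.

Lemma tangent_measureN (R : realType) (f : R -> R) (c d : R) s X :
  tangent_measure (\- f) c d s (reflect \o X) = tangent_measure f c d s X.
Proof.
apply: eq_bigr => j _; congr (_ + _).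
  exact: (euclid_dist_reflect (graph_pt f _) (X j)).
exact: (euclid_dist_reflect (X j) (graph_pt f _)).
Qed.

Lemma opp_funK (R : realType) (f : R -> R) : \- (\- f) = f.
Proof. by apply/funext => x /=; rewrite opprK. Qed.

Lemma secant_measuresN (R : realType) (f : R -> R) (a b c d : R) :
  secant_measures (\- f) a b c d = secant_measures f a b c d.
Proof.
(* Negation is an involution, so one inclusion for every [g] yields both. *)
suff sub g : secant_measures g a b c d `<=` secant_measures (\- g) a b c d.
  by apply/seteqP; split=> //; rewrite -{2}(opp_funK f).
move=> _ [s adm ->]; exists s; first exact: admissibleN.
by rewrite secant_measureN.
Qed.

Lemma tangent_measuresN (R : realType) (f : R -> R) (a b c d : R) :
  tangent_measures (\- f) a b c d = tangent_measures f a b c d.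
Proof.
suff sub g : tangent_measures g a b c d `<=` tangent_measures (\- g) a b c d.
  by apply/seteqP; split=> //; rewrite -{2}(opp_funK f).
move=> _ [s [X [adm h ->]]]; exists s, (reflect \o X); split.
- exact: admissibleN.
- by move=> j js; exact/is_tangent_intersectionN/h.
- by rewrite tangent_measureN.
Qed.

Lemma arc_lengthN (R : realType) (f : R -> R) (c d : R) :
  arc_length (\- f) c d = arc_length f c d.
Proof.
rewrite /arc_length; congr ereal_sup; apply: eq_imagel => s _.
by rewrite secant_measureN.
Qed.

Theorem theorem2 (R : realType) (f : R -> R) (a b c d : R)
    (hf : cavex_segment f a b c d) :
  ereal_sup [set S%:E | S in secant_measures f a b c d] = arc_length f c d /\
  ereal_inf [set T%:E | T in tangent_measures f a b c d] = arc_length f c d.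
Proof.
case: hf => fc ac cd db [cf|cf].
  exact: convex_measures (convex_function_below_chords cf).
have := convex_measures (is_curveN fc) ac cd db (convex_function_below_chords cf).
by rewrite secant_measuresN tangent_measuresN arc_lengthN.
Qed.
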